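(* Let $\theta\in\mathbb R\setminus\mathbb Q$. Then the Hochschild cohomology of $\mathcal A_\theta^{alg}\rtimes\mathbb Z_2$ with coefficients in its linear dual satisfies $H^0(\mathcal A_\theta^{alg}\rtimes\mathbb Z_2,(\mathcal A_\theta^{alg}\rtimes\mathbb Z_2)^* )\cong\mathbb C^5$, $H^1(\mathcal A_\theta^{alg}\rtimes\mathbb Z_2,(\mathcal A_\theta^{alg}\rtimes\mathbb Z_2)^* )=0$, and $H^2(\mathcal A_\theta^{alg}\rtimes\mathbb Z_2,(\mathcal A_\theta^{alg}\rtimes\mathbb Z_2)^* )\cong\mathbb C$.
   Context: Let $\lambda=e^{2\pi i\theta}$. The algebraic noncommutative torus $\mathcal A_\theta^{alg}$ is the complex algebra of finite linear combinations $\sum a_{n,m}U_1^nU_2^m$ ($(n,m)\in\mathbb Z^2$) generated by invertible elements $U_1,U_2$ subject to $U_2U_1=\lambda U_1U_2$. The group $\mathbb Z_2=\{1,-1\}$ acts on $\mathcal A_\theta^{alg}$ by the automorphism $\sigma$ with $\sigma(U_j)=U_j^{-1}$, $j=1,2$. The crossed product $\mathcal A_\theta^{alg}\rtimes\mathbb Z_2$ is the algebra generated by $\mathcal A_\theta^{alg}$ and an element $t$ with $t^2=1$ and $tat=\sigma(a)$ for $a\in\mathcal A_\theta^{alg}$. For an algebra $B$, $B^*$ denotes its algebraic linear dual with the standard $B$-bimodule structure, and $H^\bullet(B,M)$ denotes Hochschild cohomology with coefficients in the bimodule $M$. *)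

(* Defs.v *)
From Stdlib Require Import Reals ZArith List.
Open Scope R_scope.

Definition C : Type := (R * R)%type.
Definition C0 : C := (0, 0).
Definition C1 : C := (1, 0).
Definition Cadd (x y : C) : C := (fst x + fst y, snd x + snd y).
Definition Cmul (x y : C) : C :=
  (fst x * fst y - snd x * snd y, fst x * snd y + snd x * fst y).
Definition Copp (x : C) : C := (- fst x, - snd x).
Definition Csign (n : nat) : C := if Nat.even n then C1 else Copp C1.

Definition lam_pow (theta : R) (k : Z) : C :=
  (cos (2 * PI * theta * IZR k), sin (2 * PI * theta * IZR k)).

(* Monomial basis: (a, b, e) stands for U1^a U2^b t^e  (e = true means t^1).
   These monomials form a C-basis of A_theta^alg x| Z_2. *)
Definition Bas : Type := (Z * Z * bool)%type.

(* Product of two basis monomials: a scalar times a basis monomial.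
   U1^a U2^b t^e . U1^c U2^d t^f = U1^a U2^b sigma^e(U1^c U2^d) t^(e+f)
   = lambda^(b c') U1^(a+c') U2^(b+d') t^(e xor f),
   where (c',d') = (c,d) if e = 0 and (-c,-d) if e = 1
   (using U2^m U1^p = lambda^(m p) U1^p U2^m and t^2 = 1). *)
Definition mulB (theta : R) (x y : Bas) : C * Bas :=
  let '(a, b, e) := x in
  let '(c, d, f) := y in
  let c' := if e then (- c)%Z else c in
  let d' := if e then (- d)%Z else d in
  (lam_pow theta (b * c'), ((a + c')%Z, (b + d')%Z, xorb e f)).

(* A linear functional on B is the same as an arbitrary function on the basis. *)
Definition Dual : Type := Bas -> C.

Definition lact (theta : R) (x : Bas) (phi : Dual) : Dual :=
  fun y => let '(s, z) := mulB theta y x in Cmul s (phi z).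
Definition ract (theta : R) (phi : Dual) (x : Bas) : Dual :=
  fun y => let '(s, z) := mulB theta x y in Cmul s (phi z).

(* An n-cochain is a C-linear map B^{(x)n} -> B^*, i.e. a multilinear map
   B^n -> B^*, which is the same as an arbitrary function on n-tuples of
   basis monomials.  We represent it as a function on lists; only its values
   on lists of length n are relevant. *)
Definition Cochain : Type := list Bas -> Dual.

(* All contractions x_i x_{i+1} of adjacent entries, i = 0, 1, ...,
   each written as (scalar, contracted list) by multilinearity. *)
Fixpoint contr (theta : R) (xs : list Bas) : list (C * list Bas) :=
  match xs with
  | x :: ((y :: rest) as tl) =>
      let '(s, z) := mulB theta x y in
      (s, z :: rest) :: map (fun p => (fst p, x :: snd p)) (contr theta tl)
  | _ => nil
  end.

Fixpoint sumi (i : nat) (l : list (C * list Bas)) (f : Cochain) (y : Bas) : C :=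
  match l with
  | nil => C0
  | (c, l') :: r => Cadd (Cmul (Csign (S i)) (Cmul c (f l' y))) (sumi (S i) r f y)
  end.

Definition hdiff (theta : R) (f : Cochain) (xs : list Bas) (y : Bas) : C :=
  match xs with
  | nil => C0
  | x0 :: rest =>
      Cadd (lact theta x0 (f rest) y)
        (Cadd (sumi 0 (contr theta xs) f y)
              (Cmul (Csign (length xs)) (ract theta (f (removelast xs)) (last xs x0) y)))
  end.

Definition cocycle (theta : R) (n : nat) (f : Cochain) : Prop :=
  forall xs, length xs = S n -> forall y, hdiff theta f xs y = C0.

Definition coboundary (theta : R) (n : nat) (f : Cochain) : Prop :=
  match n with
  | O => forall y, f nil y = C0
  | S m => exists g : Cochain,
      forall xs, length xs = S m -> forall y, f xs y = hdiff theta g xs y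
  end.

Definition csub (f g : Cochain) : Cochain := fun xs y => Cadd (f xs y) (Copp (g xs y)).

Fixpoint lincomb (k : nat) (c : nat -> C) (v : nat -> Cochain) : Cochain :=
  match k with
  | O => fun _ _ => C0
  | S k' => fun xs y => Cadd (lincomb k' c v xs y) (Cmul (c k') (v k' xs y))
  end.

(* H^n(B, B^* ) is isomorphic to C^k: there are k cocycles whose classes form a
   basis of (n-cocycles)/(n-coboundaries). *)
Definition HH_dim (theta : R) (n k : nat) : Prop :=
  exists v : nat -> Cochain,
    (forall i, (i < k)%nat -> cocycle theta n (v i)) /\
    (forall f, cocycle theta n f -> exists c : nat -> C, coboundary theta n (csub f (lincomb k c v))) /\
    (forall c : nat -> C, coboundary theta n (lincomb k c v) -> forall i, (i < k)%nat -> c i = C0).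

(* Main.v *)
(* B is a twisted group algebra of G = Z^2 x| Z_2, so its Hochschild cochains
   with values in B^* are group cochains of G with values in the functions on G,
   where G acts by conjugation up to powers of lambda. This module is a product
   over conjugacy classes. On the four classes of reflections the stabilisers
   have order two, so averaging over them contracts everything above degree 0.
   On a class {y, y^-1} of nontrivial translations some class sum n + n^-1 of the
   group algebra acts by a scalar 2 cos(2 pi theta k), which differs from its
   augmentation 2 because theta is irrational, so the cohomology vanishes. On the
   class of 1 what remains is H^n(G, C) = H^n(Z^2, C)^(Z_2), which is C, 0, C. *)

From Stdlib Require Import Reals ZArith List Lra Lia Bool.
Require Import Defs.
Open Scope R_scope.

(** * Complex scalars and powers of lambda *)

Definition Csub (x y : C) : C := Cadd x (Copp y).

Lemma C_ring : ring_theory C0 C1 Cadd Cmul Csub Copp (@eq C).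
Proof.
constructor; repeat intros [? ?]; cbv [C0 C1 Cadd Cmul Csub Copp fst snd];
  f_equal; ring.
Qed.
Add Ring C_ring_inst : C_ring.

Definition Chalf : C := (1 / 2, 0).

Lemma Chalf_double (x : C) : Cadd (Cmul Chalf x) (Cmul Chalf x) = x.
Proof. destruct x; cbv [Chalf Cadd Cmul fst snd]; f_equal; field. Qed.

Lemma lam_add (theta : R) (k l : Z) :
  lam_pow theta (k + l) = Cmul (lam_pow theta k) (lam_pow theta l).
Proof.
cbv [lam_pow Cmul fst snd]; rewrite plus_IZR, Rmult_plus_distr_l, cos_plus, sin_plus.
f_equal; ring.
Qed.

Lemma lam_0 (theta : R) : lam_pow theta 0 = C1.
Proof.
cbv [lam_pow C1]; replace (2 * PI * theta * 0) with 0 by ring.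
now rewrite cos_0, sin_0.
Qed.

Lemma lam_cancel (theta : R) (k : Z) (x y : C) :
  Cmul (lam_pow theta k) x = Cmul (lam_pow theta k) y -> x = y.
Proof.
intros H.
assert (E : Cmul (lam_pow theta (- k)) (lam_pow theta k) = C1).
{ rewrite <- lam_add, Z.add_opp_diag_l; apply lam_0. }
transitivity (Cmul (Cmul (lam_pow theta (- k)) (lam_pow theta k)) x).
- rewrite E; ring.
- transitivity (Cmul (lam_pow theta (- k)) (Cmul (lam_pow theta k) x)); [ring|].
  rewrite H.
  transitivity (Cmul (Cmul (lam_pow theta (- k)) (lam_pow theta k)) y); [ring|].
  rewrite E; ring.
Qed.

(** If the cosine is 1, then sin(pi theta k) = 0, so theta k is an integer p and theta = p / k. *)
Lemma lam_cos_neq1 (theta : R) (k : Z)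
  (Hirr : forall p q : Z, q <> 0%Z -> theta <> IZR p / IZR q) :
  k <> 0%Z -> cos (2 * PI * theta * IZR k) <> 1.
Proof.
intros Hk H.
replace (2 * PI * theta * IZR k) with (2 * (PI * theta * IZR k)) in H by ring.
rewrite cos_2a_sin in H.
assert (Hs : sin (PI * theta * IZR k) = 0) by nra.
destruct (sin_eq_0_0 _ Hs) as [p Hp].
apply (Hirr p k Hk).
assert (Hk' : IZR k <> 0) by now apply not_0_IZR.
assert (HPI := PI_neq0).
apply (Rmult_eq_reg_l PI); [|assumption].
apply (Rmult_eq_reg_r (IZR k)); [|assumption].
rewrite Hp; field; assumption.
Qed.

(** * The group Z^2 x| Z_2 and its twisting cocycle *)

Definition gone : Bas := (0%Z, 0%Z, false).
Definition gsg (e : bool) (c : Z) : Z := if e then (- c)%Z else c.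
Definition gm (x y : Bas) : Bas :=
  let '(a, b, e) := x in
  let '(c, d, f) := y in
  ((a + gsg e c)%Z, (b + gsg e d)%Z, xorb e f).
Definition gi (x : Bas) : Bas :=
  let '(a, b, e) := x in (gsg e (- a), gsg e (- b), e).
(** The twisting 2-cocycle in exponent form: u_x u_y = lambda^(gw x y) u_(gm x y). *)
Definition gw (x y : Bas) : Z :=
  let '(a, b, e) := x in let '(c, d, f) := y in (b * gsg e c)%Z.

Ltac gcases :=
  repeat match goal with
  | x : Bas |- _ => destruct x as [[? ?] []]
  end.
Ltac gsolve :=
  gcases; cbn [gm gi gw gone gsg xorb]; try ring; repeat apply (f_equal2 pair); try reflexivity; try ring.

Lemma mulB_gm (theta : R) (x y : Bas) :
  mulB theta x y = (lam_pow theta (gw x y), gm x y).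
Proof. gcases; reflexivity. Qed.

Lemma gmA (x y z : Bas) : gm x (gm y z) = gm (gm x y) z.
Proof. gsolve. Qed.
Lemma gVm (x y : Bas) : gm (gi x) (gm x y) = y.
Proof. gsolve. Qed.
Lemma gmV (x y : Bas) : gm x (gm (gi x) y) = y.
Proof. gsolve. Qed.
Lemma gi_gm (x y z : Bas) : gm (gi (gm x y)) z = gm (gi y) (gm (gi x) z).
Proof. gsolve. Qed.
Lemma gw_cocycle (x y z : Bas) :
  (gw x y + gw (gm x y) z = gw y z + gw x (gm y z))%Z.
Proof. gsolve. Qed.

(** * From Hochschild cochains to twisted group cochains *)

Definition gconj (g y : Bas) : Bas := gm (gi g) (gm y g).
(** The exponent in u_g^-1 u_z u_g = lambda^(gex g z) u_(gconj g z). Thus [act] sends phi to u_g phi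
    u_g^-1, that is, z to phi(u_g^-1 z u_g). *)
Definition gex (g z : Bas) : Z := (gw (gm (gi g) z) g - gw g (gm (gi g) z))%Z.
Definition act (theta : R) (g : Bas) (phi : Dual) : Dual :=
  fun z => Cmul (lam_pow theta (gex g z)) (phi (gconj g z)).

(** [d0], [d1], [d2] are the inhomogeneous bar differentials of the group, with coefficients in the
    dual under [act]. *)
Definition d0 (theta : R) (m : Dual) (g : Bas) : Dual :=
  fun y => Csub (act theta g m y) (m y).
Definition d1 (theta : R) (h : Bas -> Dual) (g k : Bas) : Dual :=
  fun y => Cadd (Csub (act theta g (h k) y) (h (gm g k) y)) (h g y).
Definition d2 (theta : R) (F : Bas -> Bas -> Dual) (g k l : Bas) : Dual :=
  fun y => Csub (Cadd (Csub (act theta g (F k l) y) (F (gm g k) l y))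
                      (F g (gm k l) y)) (F g k y).

(** u_x phi - phi u_x = (u_x phi u_x^-1 - phi) u_x. *)
Lemma hdiff0 (theta : R) (f : Cochain) (x y : Bas) :
  hdiff theta f (x :: nil) y =
  Cmul (lam_pow theta (gw x y)) (d0 theta (f nil) x (gm x y)).
Proof.
unfold hdiff, lact, ract, d0, act, gconj; simpl; rewrite !mulB_gm.
unfold gex; rewrite gVm, <- !gmA, gVm.
replace (lam_pow theta (gw y x))
  with (lam_pow theta (gw x y + (gw y x - gw x y))) by (f_equal; ring).
rewrite lam_add.
cbv [Csign Nat.even]; ring.
Qed.

(* [f(x, x') = F(x, x') . u_x u_x'] in [B^*], where [u_x] is the monomial [x]; the
   exponent is that of [u_x u_x' u_y]. *)
Definition rep1 (theta : R) (f : Cochain) (h : Bas -> Dual) : Prop :=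
  forall x y, f (x :: nil) y = Cmul (lam_pow theta (gw x y)) (h x (gm x y)).
Definition rep2 (theta : R) (f : Cochain) (F : Bas -> Bas -> Dual) : Prop :=
  forall x x' y, f (x :: x' :: nil) y =
    Cmul (lam_pow theta (gw x (gm x' y) + gw x' y)) (F x x' (gm x (gm x' y))).

(** Right multiplication by u_x is invertible on the dual, so the defining equation can be solved
    for h. *)
Lemma rep1_ex (theta : R) (f : Cochain) : exists h, rep1 theta f h.
Proof.
exists (fun x z => Cmul (lam_pow theta (- gw x (gm (gi x) z))) (f (x :: nil) (gm (gi x) z))).
intros x y; rewrite gVm.
transitivity (Cmul (Cmul (lam_pow theta (gw x y)) (lam_pow theta (- gw x y))) (f (x :: nil) y)); [|ring].
rewrite <- lam_add, Z.add_opp_diag_r, lam_0; ring.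
Qed.

Lemma rep2_ex (theta : R) (f : Cochain) : exists F, rep2 theta f F.
Proof.
exists (fun x x' z =>
  let y := gm (gi x') (gm (gi x) z) in
  Cmul (lam_pow theta (- (gw x (gm x' y) + gw x' y))) (f (x :: x' :: nil) y)).
intros x x' y; cbv zeta; rewrite gVm, gVm.
set (k := (_ + _)%Z).
transitivity (Cmul (Cmul (lam_pow theta k) (lam_pow theta (- k))) (f (x :: x' :: nil) y)); [|ring].
rewrite <- lam_add, Z.add_opp_diag_r, lam_0; ring.
Qed.

(** With f(x) = h(x) u_x, a factor u_x u_x' splits off on the right of every term, and the left
    action of u_x turns into conjugation. *)
Lemma hdiff1 (theta : R) (f : Cochain) (h : Bas -> Dual) (x x' y : Bas) :
  rep1 theta f h ->
  hdiff theta f (x :: x' :: nil) y =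
  Cmul (lam_pow theta (gw x (gm x' y) + gw x' y)) (d1 theta h x x' (gm x (gm x' y))).
Proof.
intros Hf.
unfold hdiff, lact, ract, d1, act, gconj; simpl; rewrite !mulB_gm; simpl.
rewrite !Hf, !gmA.
unfold gex; rewrite <- !gmA, !gVm.
(* With the conjugation exponent absorbed, [E1] compares the two bracketings of u_x' u_y u_x; [E2]
   compares those of u_x u_x' u_y. *)
assert (E1 : (gw x (gm x' y) + gw x' y + (gw (gm x' y) x - gw x (gm x' y))
   = gw y x + gw x' (gm y x))%Z) by (generalize (gw_cocycle x' y x); lia).
assert (E2 : (gw x (gm x' y) + gw x' y = gw x x' + gw (gm x x') y)%Z)
  by (generalize (gw_cocycle x x' y); lia).
transitivity (Cadd (Csub
  (Cmul (lam_pow theta (gw y x + gw x' (gm y x))) (h x' (gm x' (gm y x))))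
  (Cmul (lam_pow theta (gw x x' + gw (gm x x') y)) (h (gm x x') (gm x (gm x' y)))))
  (Cmul (lam_pow theta (gw x (gm x' y) + gw x' y)) (h x (gm x (gm x' y))))).
- rewrite !lam_add; cbv [Csign Nat.even]; ring.
- rewrite <- E1, <- E2, !lam_add; ring.
Qed.

Lemma hdiff2 (theta : R) (f : Cochain) (F : Bas -> Bas -> Dual) (x x' x'' y : Bas) :
  rep2 theta f F ->
  hdiff theta f (x :: x' :: x'' :: nil) y =
  Cmul (lam_pow theta (gw x (gm x' (gm x'' y)) + gw x' (gm x'' y) + gw x'' y))
    (d2 theta F x x' x'' (gm x (gm x' (gm x'' y)))).
Proof.
intros Hf.
unfold hdiff, lact, ract, d2, act, gconj; simpl; rewrite !mulB_gm; simpl.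
rewrite !Hf, !gmA.
unfold gex; rewrite <- !gmA, !gVm.
(* [W] is the exponent of u_x u_x' u_x'' u_y; [E1] to [E4] regroup it for the four terms of [d2]. *)
set (W := (gw x (gm x' (gm x'' y)) + gw x' (gm x'' y) + gw x'' y)%Z).
assert (E1 : (W + (gw (gm x' (gm x'' y)) x - gw x (gm x' (gm x'' y)))
   = gw y x + (gw x' (gm x'' (gm y x)) + gw x'' (gm y x)))%Z).
{ generalize (gw_cocycle x' (gm x'' y) x) (gw_cocycle x'' y x).
  unfold W; rewrite <- !gmA; lia. }
assert (E2 : (W = gw x x' + (gw (gm x x') (gm x'' y) + gw x'' y))%Z)
  by (unfold W; generalize (gw_cocycle x x' (gm x'' y)); lia).
assert (E3 : (W = gw x' x'' + (gw x (gm x' (gm x'' y)) + gw (gm x' x'') y))%Z)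
  by (unfold W; generalize (gw_cocycle x' x'' y); lia).
assert (E4 : (W = gw x'' y + (gw x (gm x' (gm x'' y)) + gw x' (gm x'' y)))%Z)
  by (unfold W; lia).
transitivity (Csub (Cadd (Csub
  (Cmul (lam_pow theta (gw y x + (gw x' (gm x'' (gm y x)) + gw x'' (gm y x)))) (F x' x'' (gm x' (gm x'' (gm y x)))))
  (Cmul (lam_pow theta (gw x x' + (gw (gm x x') (gm x'' y) + gw x'' y))) (F (gm x x') x'' (gm x (gm x' (gm x'' y))))))
  (Cmul (lam_pow theta (gw x' x'' + (gw x (gm x' (gm x'' y)) + gw (gm x' x'') y))) (F x (gm x' x'') (gm x (gm x' (gm x'' y))))))
  (Cmul (lam_pow theta (gw x'' y + (gw x (gm x' (gm x'' y)) + gw x' (gm x'' y)))) (F x x' (gm x (gm x' (gm x'' y)))))).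
- rewrite !lam_add; cbv [Csign Nat.even]; ring.
- rewrite <- E1, <- E2, <- E3, <- E4, !lam_add; ring.
Qed.

(** * Contracting homotopies away from the identity class *)

Definition cocycle1 (theta : R) (D : Bas -> Dual) : Prop :=
  forall g k y, d1 theta D g k y = C0.
Definition cocycle2 (theta : R) (F : Bas -> Bas -> Dual) : Prop :=
  forall g k l y, d2 theta F g k l y = C0.

Lemma Csub_eq0 (x y : C) : Csub x y = C0 -> x = y.
Proof. intros H; transitivity (Cadd (Csub x y) y); [ring | rewrite H; ring]. Qed.

Lemma cocycle1_eq (theta : R) (D : Bas -> Dual) (g k y : Bas) :
  cocycle1 theta D ->
  act theta g (D k) y = Csub (D (gm g k) y) (D g y).
Proof.
intros HD; apply Csub_eq0; rewrite <- (HD g k y); unfold d1; ring.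
Qed.

Lemma cocycle2_eq (theta : R) (F : Bas -> Bas -> Dual) (g k l y : Bas) :
  cocycle2 theta F ->
  act theta g (F k l) y =
  Cadd (Csub (F (gm g k) l y) (F g (gm k l) y)) (F g k y).
Proof.
intros HF; apply Csub_eq0; rewrite <- (HF g k l y); unfold d2; ring.
Qed.

(* The two elements [p] with [p^-1 y p = U1^(i mod 2) U2^(j mod 2) t] up to a
   scalar, for [y = U1^i U2^j t]. *)
Definition half1 (y : Bas) : Bas :=
  let '(i, j, _) := y in ((i / 2)%Z, (j / 2)%Z, false).
Definition half2 (y : Bas) : Bas :=
  let '(i, j, _) := y in ((i / 2 + i mod 2)%Z, (j / 2 + j mod 2)%Z, true).

(** If p^-1 y p = r, then g^-1 p conjugates g^-1 y g to the same r. So g^-1 carries the pair for y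
    to the pair for g^-1 y g, swapping the order when g is a reflection. *)
Lemma conj_half (g y : Bas) : snd y = true ->
  half1 (gconj g y) = gm (gi g) (half1 y) /\ half2 (gconj g y) = gm (gi g) (half2 y) \/
  half1 (gconj g y) = gm (gi g) (half2 y) /\ half2 (gconj g y) = gm (gi g) (half1 y).
Proof.
destruct y as [[i j] e]; cbn [snd]; intros ->.
destruct g as [[a b] []]; [right | left];
  cbn [gconj gm gi gsg xorb half1 half2]; split;
  repeat apply (f_equal2 pair); try reflexivity;
  Z.to_euclidean_division_equations; lia.
Qed.

Definition tw1 (D : Bas -> Dual) : Dual :=
  fun y => Copp (Cmul Chalf (Cadd (D (half1 y) y) (D (half2 y) y))).
Definition tw2 (F : Bas -> Bas -> Dual) (g : Bas) : Dual :=
  fun y => Cmul Chalf (Cadd (F g (gm (gi g) (half1 y)) y) (F g (gm (gi g) (half2 y)) y)).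

(** For p in the pair of y, g.D(g^-1 p) = D(p) - D(g) by the cocycle identity. Averaging over p
    yields the mean of D(p) minus D(g), whence the sign in [tw1]. *)
Lemma tw1_homotopy (theta : R) (D : Bas -> Dual) (g y : Bas) :
  cocycle1 theta D -> snd y = true -> d0 theta (tw1 D) g y = D g y.
Proof.
intros HD Hy; unfold d0.
assert (E : act theta g (tw1 D) y = Copp (Cmul Chalf
  (Cadd (act theta g (D (gm (gi g) (half1 y))) y) (act theta g (D (gm (gi g) (half2 y))) y)))).
{ unfold act, tw1; destruct (conj_half g y Hy) as [[-> ->] | [-> ->]]; ring. }
rewrite E, !(cocycle1_eq theta D) by assumption.
rewrite !gmV; unfold tw1.
rewrite <- (Chalf_double (D g y)) at 3; ring.
Qed.

(** Average over p the cocycle identity at (g, k, k^-1 g^-1 p): the terms other than F(g, k) are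
    those of [d1] applied to [tw2 F]. *)
Lemma tw2_homotopy (theta : R) (F : Bas -> Bas -> Dual) (g k y : Bas) :
  cocycle2 theta F -> snd y = true -> d1 theta (tw2 F) g k y = F g k y.
Proof.
intros HF Hy; unfold d1.
assert (E : act theta g (tw2 F k) y = Cmul Chalf
  (Cadd (act theta g (F k (gm (gi k) (gm (gi g) (half1 y)))) y)
        (act theta g (F k (gm (gi k) (gm (gi g) (half2 y)))) y))).
{ unfold act, tw2; destruct (conj_half g y Hy) as [[-> ->] | [-> ->]]; ring. }
rewrite E, !(cocycle2_eq theta F) by assumption.
rewrite !gmV; unfold tw2; rewrite !gi_gm.
rewrite <- (Chalf_double (F g k y)) at 3; ring.
Qed.

(** * Nontrivial translations *)

Definition is_one (y : Bas) : bool :=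
  let '(i, j, e) := y in Z.eqb i 0 && Z.eqb j 0 && negb e.

(* A translation [n] with [u_n^-1 y u_n = lambda^k y], [k <> 0], when [y <> 1]
   is a translation; it only depends on [{y, y^-1}]. *)
Definition mover (y : Bas) : Bas :=
  let '(i, j, _) := y in if Z.eqb j 0 then (0%Z, 1%Z, false) else (1%Z, 0%Z, false).

Definition cosgap (theta : R) (y : Bas) : R :=
  2 * cos (2 * PI * theta * IZR (gex (mover y) y)) - 2.

Lemma snd_conj (g y : Bas) : snd (gconj g y) = snd y.
Proof. gcases; reflexivity. Qed.

Lemma is_one_conj (g y : Bas) : is_one (gconj g y) = is_one y.
Proof.
gcases; cbn -[Z.mul Z.eqb Z.add Z.opp]; rewrite ?andb_false_r, ?andb_true_r; try reflexivity;
  apply eq_true_iff_eq; rewrite !andb_true_iff, !Z.eqb_eq; lia.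
Qed.

(** The alternative depends only on whether g is a translation or a reflection, so a single case
    split handles n and n^-1 together. *)
Lemma conj_translation (g : Bas) :
  (forall n, snd n = false -> gconj g n = n) \/
  (forall n, snd n = false -> gconj g n = gi n).
Proof.
destruct g as [[a b] []]; [right | left];
  intros [[c d] e]; cbn [snd]; intros ->; cbn [gconj gm gi gsg xorb];
  repeat apply (f_equal2 pair); try reflexivity; ring.
Qed.

Lemma conj_g (g n : Bas) : gm g (gconj g n) = gm n g.
Proof. unfold gconj; apply gmV. Qed.

Lemma mover_gi (y : Bas) : mover (gi y) = mover y.
Proof.
destruct y as [[i j] []]; cbn [mover gi gsg];
  [destruct (Z.eqb_spec (- - j) 0), (Z.eqb_spec j 0)
  | destruct (Z.eqb_spec (- j) 0), (Z.eqb_spec j 0)]; reflexivity || lia.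
Qed.

Lemma snd_mover (y : Bas) : snd (mover y) = false.
Proof. destruct y as [[i j] e]; cbn [mover]; now destruct (Z.eqb j 0). Qed.

Lemma gi_gi (y : Bas) : gi (gi y) = y.
Proof. gsolve. Qed.

Lemma gex_translation (n y : Bas) : snd n = false -> snd y = false ->
  gconj n y = y /\ gex (gi n) y = (- gex n y)%Z /\ gex n (gi y) = (- gex n y)%Z.
Proof.
destruct n as [[? ?] ?], y as [[? ?] ?]; cbn [snd]; intros -> ->.
unfold gconj, gex; cbn [gm gi gsg gw xorb]; split; [|split];
  repeat apply (f_equal2 pair); try reflexivity; ring.
Qed.

(** For y = U1^i U2^j the exponent is j when j is nonzero, and -i otherwise. *)
Lemma gex_mover (y : Bas) : snd y = false -> is_one y = false -> gex (mover y) y <> 0%Z.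
Proof.
destruct y as [[i j] e]; cbn [snd]; intros ->; cbn [is_one mover].
unfold gex; destruct (Z.eqb_spec j 0), (Z.eqb_spec i 0); cbn [gm gi gw gsg xorb andb negb];
  try discriminate; lia.
Qed.

Lemma cosgap_neq0 (theta : R) (y : Bas)
  (Hirr : forall p q : Z, q <> 0%Z -> theta <> IZR p / IZR q) :
  snd y = false -> is_one y = false -> cosgap theta y <> 0.
Proof.
intros H1 H2 H.
apply (lam_cos_neq1 theta _ Hirr (gex_mover y H1 H2)); unfold cosgap in H; lra.
Qed.

Lemma cosgap_conj (theta : R) (g y : Bas) : snd y = false ->
  cosgap theta (gconj g y) = cosgap theta y.
Proof.
intros Hy; destruct (conj_translation g) as [H | H]; rewrite (H y Hy); [reflexivity|].
unfold cosgap; rewrite mover_gi.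
destruct (gex_translation (mover y) y (snd_mover y) Hy) as (_ & _ & ->).
rewrite opp_IZR; replace (2 * PI * theta * - IZR (gex (mover y) y))
  with (- (2 * PI * theta * IZR (gex (mover y) y))) by ring.
now rewrite cos_neg.
Qed.

(** Conjugation by n and n^-1 fixes y up to the scalars lambda^k and lambda^-k, whose sum is 2 cos(2
    pi theta k). *)
Lemma act_mover (theta : R) (phi : Dual) (y : Bas) : snd y = false ->
  Csub (Cadd (act theta (mover y) phi y) (act theta (gi (mover y)) phi y))
       (Cadd (phi y) (phi y))
  = Cmul (cosgap theta y, 0) (phi y).
Proof.
intros Hy.
destruct (gex_translation (mover y) y (snd_mover y) Hy) as (E1 & E2 & _).
assert (Hi : snd (gi (mover y)) = false).
{ generalize (snd_mover y); now destruct (mover y) as [[? ?] []]. }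
destruct (gex_translation (gi (mover y)) y Hi Hy) as (E3 & _ & _).
unfold act; rewrite E1, E3, E2.
unfold cosgap, lam_pow; rewrite opp_IZR; set (k := IZR (gex (mover y) y)).
replace (2 * PI * theta * - k) with (- (2 * PI * theta * k)) by ring.
rewrite cos_neg, sin_neg.
destruct (phi y); cbv [Csub Cadd Copp Cmul fst snd]; f_equal; ring.
Qed.

(* The class sum of [n] acts on the [{y, y^-1}]-component by [2 cos], whereas
   its augmentation is 2; the prism homotopy between the two, divided by the
   difference, contracts the component. *)
Definition ce1 (theta : R) (D : Bas -> Dual) : Dual := fun y =>
  let n := mover y in
  Cmul (/ cosgap theta y, 0) (Cadd (D n y) (D (gi n) y)).
Definition prism (F : Bas -> Bas -> Dual) (n g : Bas) : Dual := fun y =>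
  Csub (F n g y) (F g (gconj g n) y).
Definition ce2 (theta : R) (F : Bas -> Bas -> Dual) (g : Bas) : Dual := fun y =>
  let n := mover y in
  Cmul (/ cosgap theta y, 0) (Cadd (prism F n g y) (prism F (gi n) g y)).

Lemma Cinv_real (r : R) (x y : C) : r <> 0 -> x = Cmul (r, 0) y -> Cmul (/ r, 0) x = y.
Proof.
intros Hr ->; destruct y; cbv [Cmul fst snd]; f_equal; field; assumption.
Qed.

Lemma mover_conj (g y : Bas) : snd y = false -> mover (gconj g y) = mover y.
Proof.
intros Hy; destruct (conj_translation g) as [H | H]; rewrite (H y Hy);
  [reflexivity | apply mover_gi].
Qed.

(** From g.D(g^-1 n g) = D(n g) - D(g) and n.D(g) = D(n g) - D(n) follows g.D(g^-1 n g) - D(n) =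
    n.D(g) - D(g). Summing over n and n^-1 gives [cosgap] times D(g). *)
Lemma ce1_homotopy (theta : R) (D : Bas -> Dual) (g y : Bas)
  (Hirr : forall p q : Z, q <> 0%Z -> theta <> IZR p / IZR q) :
  cocycle1 theta D -> snd y = false -> is_one y = false ->
  d0 theta (ce1 theta D) g y = D g y.
Proof.
intros HD Hy Hy1; set (n := mover y).
(* Conjugation by g permutes n and n^-1, so their sum may be re-indexed by the conjugates. *)
assert (E : act theta g (ce1 theta D) y = Cmul (/ cosgap theta y, 0)
  (Cadd (act theta g (D (gconj g n)) y) (act theta g (D (gconj g (gi n))) y))).
{ unfold act, ce1; rewrite cosgap_conj, mover_conj by assumption; fold n.
  assert (Hn : snd n = false) by apply snd_mover.
  assert (Hi : snd (gi n) = false) by (destruct n as [[? ?] []]; assumption).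
  destruct (conj_translation g) as [H | H]; rewrite (H n Hn), (H (gi n) Hi), ?gi_gi; ring. }
unfold d0; rewrite E; unfold ce1; cbv zeta; fold n.
transitivity (Cmul (/ cosgap theta y, 0) (Csub
  (Cadd (act theta g (D (gconj g n)) y) (act theta g (D (gconj g (gi n))) y))
  (Cadd (D n y) (D (gi n) y)))); [ring|].
apply Cinv_real; [now apply cosgap_neq0|].
rewrite <- act_mover by assumption; fold n.
rewrite !(cocycle1_eq theta D) by assumption; rewrite !conj_g; ring.
Qed.

(** Writing P for [prism F], three cocycle identities give g.P(g^-1 n g, k) - P(n, g k) + P(n, g) =
    n.F(g, k) - F(g, k), which is summed over n and n^-1. *)
Lemma ce2_homotopy (theta : R) (F : Bas -> Bas -> Dual) (g k y : Bas)
  (Hirr : forall p q : Z, q <> 0%Z -> theta <> IZR p / IZR q) :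
  cocycle2 theta F -> snd y = false -> is_one y = false ->
  d1 theta (ce2 theta F) g k y = F g k y.
Proof.
intros HF Hy Hy1; set (n := mover y).
assert (E : act theta g (ce2 theta F k) y = Cmul (/ cosgap theta y, 0)
  (Cadd (act theta g (prism F (gconj g n) k) y) (act theta g (prism F (gconj g (gi n)) k) y))).
{ unfold act, ce2; rewrite cosgap_conj, mover_conj by assumption; fold n.
  assert (Hn : snd n = false) by apply snd_mover.
  assert (Hi : snd (gi n) = false) by (destruct n as [[? ?] []]; assumption).
  destruct (conj_translation g) as [H | H]; rewrite (H n Hn), (H (gi n) Hi), ?gi_gi; ring. }
unfold d1; rewrite E; unfold ce2; cbv zeta; fold n.
transitivity (Cmul (/ cosgap theta y, 0) (Cadd (Csub
  (Cadd (act theta g (prism F (gconj g n) k) y) (act theta g (prism F (gconj g (gi n)) k) y))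
  (Cadd (prism F n (gm g k) y) (prism F (gi n) (gm g k) y)))
  (Cadd (prism F n g y) (prism F (gi n) g y)))); [ring|].
apply Cinv_real; [now apply cosgap_neq0|].
rewrite <- act_mover by assumption; fold n.
assert (P : forall c, act theta g (prism F (gconj g c) k) y =
  Csub (act theta g (F (gconj g c) k) y) (act theta g (F k (gconj k (gconj g c))) y)).
{ intros c; unfold act, prism; ring. }
rewrite !P, !(cocycle2_eq theta F) by assumption; unfold prism; rewrite !conj_g.
assert (Q : forall c, gconj (gm g k) c = gconj k (gconj g c)).
{ intros c; unfold gconj; now rewrite !gi_gm, !gmA. }
rewrite !Q; ring.
Qed.

(** * Second cohomology with trivial coefficients *)

(** Real coefficients suffice, since a complex cocycle splits into its real and imaginary parts. *)
Definition rcocycle2 (F : Bas -> Bas -> R) : Prop :=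
  forall g k l, F k l - F (gm g k) l + F g (gm k l) - F g k = 0.

Definition tr (i j : Z) : Bas := (i, j, false).
Definition gt : Bas := (0%Z, 0%Z, true).

Lemma additive_eq0 (phi : Bas -> R) :
  (forall i j k l, phi (gm (tr i j) (tr k l)) = phi (tr i j) + phi (tr k l)) ->
  phi (tr 1 0) = 0 -> phi (tr 0 1) = 0 -> forall i j, phi (tr i j) = 0.
Proof.
intros H H10 H01.
assert (A1 : forall i, phi (tr i 0) = 0).
{ intros i; pattern i; apply Z.bi_induction.
  - now intros ? ? ->.
  - generalize (H 0 0 0 0)%Z; cbn; unfold tr; lra.
  - intros z; generalize (H 1 0 z 0)%Z.
    replace (gm (tr 1 0) (tr z 0)) with (tr (Z.succ z) 0)
      by (unfold tr; gsolve; lia).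
    lra. }
assert (A2 : forall j, phi (tr 0 j) = 0).
{ intros j; pattern j; apply Z.bi_induction.
  - now intros ? ? ->.
  - generalize (H 0 0 0 0)%Z; cbn; unfold tr; lra.
  - intros z; generalize (H 0 1 0 z)%Z.
    replace (gm (tr 0 1) (tr 0 z)) with (tr 0 (Z.succ z))
      by (unfold tr; gsolve; lia).
    lra. }
intros i j; generalize (H i 0 0 j)%Z.
replace (gm (tr i 0) (tr 0 j)) with (tr i j) by (unfold tr; gsolve; lia).
rewrite A1, A2; lra.
Qed.

Lemma tr_comm (i j k l : Z) : gm (tr i j) (tr k l) = gm (tr k l) (tr i j).
Proof. unfold tr; gsolve. Qed.

Lemma gm_tr (i j k l : Z) : gm (tr i j) (tr k l) = tr (i + k) (j + l).
Proof. reflexivity. Qed.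

(* [F n m - F m n] is biadditive on translations. *)
Lemma rcocycle2_sym (F : Bas -> Bas -> R) : rcocycle2 F ->
  F (tr 1 0) (tr 0 1) = F (tr 0 1) (tr 1 0) ->
  forall i j k l, F (tr i j) (tr k l) = F (tr k l) (tr i j).
Proof.
intros HF H.
set (beta := fun n m => F n m - F m n).
assert (L : forall k l i j i' j', beta (gm (tr i j) (tr i' j')) (tr k l)
  = beta (tr i j) (tr k l) + beta (tr i' j') (tr k l)).
{ intros k l i j i' j'; unfold beta.
  (* Additivity of [beta] is the shuffle combination of the cocycle identity: with a, b the two
     summands and c = [tr k l], the instances (a, b, c) and (c, a, b) minus (a, c, b). *)
  generalize (HF (tr i j) (tr i' j') (tr k l)) (HF (tr k l) (tr i j) (tr i' j'))
    (HF (tr i j) (tr k l) (tr i' j')).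
  rewrite (tr_comm k l i j), (tr_comm k l i' j'); lra. }
assert (Z1 : forall i j, beta (tr i j) (tr 1 0) = 0).
{ apply (additive_eq0 (fun n => beta n (tr 1 0))); [apply L | |]; unfold beta; lra. }
assert (Z2 : forall i j, beta (tr i j) (tr 0 1) = 0).
{ apply (additive_eq0 (fun n => beta n (tr 0 1))); [apply L | |]; unfold beta; lra. }
intros i j k l.
assert (Z3 : beta (tr i j) (tr k l) = 0).
{ revert i j; apply (additive_eq0 (fun n => beta n (tr k l))); [apply L | |].
  - generalize (Z1 k l); unfold beta; lra.
  - generalize (Z2 k l); unfold beta; lra. }
unfold beta in Z3; lra.
Qed.

Definition rd1 (h : Bas -> R) (g k : Bas) : R := h k - h (gm g k) + h g.

Lemma rd1_cocycle (h : Bas -> R) : rcocycle2 (rd1 h).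
Proof. intros g k l; unfold rd1; rewrite gmA; ring. Qed.

(* Read [F] as a central extension; the hypotheses say that the tautological
   section [s] has [s(tn)^2 = 1], [s(t) s(n) = s(tn)] and is commutative on
   translations. Conjugating [s(n) s(m) = F n m + s(nm)] by [s(t)] gives
   [F n m = - F m n], hence [F n m = 0]. *)
Lemma rcocycle2_eq0 (F : Bas -> Bas -> R) : rcocycle2 F ->
  (forall i j, F (gm gt (tr i j)) (gm gt (tr i j)) = 0) ->
  (forall i j, F gt (tr i j) = 0) ->
  (forall i j k l, F (tr i j) (tr k l) = F (tr k l) (tr i j)) ->
  forall g k, F g k = 0.
Proof.
intros HF Hsq Ht Hs.
assert (E1 : forall x, gm gone x = x) by (intros; gsolve).
assert (E2 : forall x, gm x gone = x) by (intros; gsolve).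
assert (F11 : F gone gone = 0).
{ generalize (HF gt gone gone) (Ht 0 0)%Z; rewrite !E2; fold gone; unfold tr; fold gone; lra. }
assert (F1 : forall x, F gone x = 0).
{ intros x; generalize (HF gone gone x); rewrite !E1; lra. }
assert (Ftt : F gt gt = 0) by apply (Hsq 0 0)%Z.
assert (Ft : forall i j, F gt (gm gt (tr i j)) = 0).
{ intros i j; generalize (HF gt gt (tr i j)); change (gm gt gt) with gone.
  rewrite F1, Ht; lra. }
assert (Ftn : forall i j k l, F (gm gt (tr i j)) (tr k l) = F (tr i j) (tr k l)).
{ intros i j k l; generalize (HF gt (tr i j) (tr k l)).
  rewrite gm_tr, !Ht; lra. }
assert (Et : forall i j, gm (tr i j) gt = gm gt (tr (- i) (- j))).
{ intros; unfold tr, gt; gsolve. }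
assert (Ftt' : forall i j k l,
  F (gm gt (tr i j)) (gm gt (tr k l)) = F (tr i j) (gm gt (tr k l))).
{ intros i j k l; generalize (HF gt (tr i j) (gm gt (tr k l))).
  rewrite (gmA (tr i j)), Et, <- gmA, gm_tr, Ft, Ht; lra. }
(* In the extension s(n) s(t) = s(t) s(n)^-1, and s(n)^-1 differs from s(n^-1) by -F(n^-1, n). *)
assert (Fnt : forall i j, F (tr i j) gt = - F (tr (- i) (- j)) (tr i j)).
{ intros i j; generalize (HF (tr i j) gt (tr i j)) (Hsq i j).
  rewrite Et, Ftn, Ht, Ftt'; lra. }
assert (Fntm : forall i j k l, F (tr i j) (gm gt (tr k l)) =
  F (tr (- i) (- j)) (tr k l) - F (tr (- i) (- j)) (tr i j)).
{ intros i j k l; generalize (HF (tr i j) gt (tr k l)).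
  rewrite Et, Ftn, Ht, Fnt; lra. }
assert (F0 : forall i j k l, F (tr i j) (tr k l) = 0).
{ intros i j k l.
  generalize (HF (tr i j) (tr k l) gt).
  rewrite Et, Fntm, gm_tr, !Fnt.
  (* Commutativity on translations and these identities give F(n, m) = F(n, n^-1) + F(m, m^-1) -
     F(nm, (nm)^-1) - F(n^-1, m^-1). The identity at (n, m, t) gives the negative of this value. *)
  generalize (HF (tr i j) (tr k l) (tr (- (i + k)) (- (j + l))))
    (HF (tr k l) (tr (- k) (- l)) (tr (- i) (- j))).
  rewrite !gm_tr.
  replace (k + - (i + k))%Z with (- i)%Z by ring.
  replace (l + - (j + l))%Z with (- j)%Z by ring.
  replace (- k + - i)%Z with (- (i + k))%Z by ring.
  replace (- l + - j)%Z with (- (j + l))%Z by ring.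
  rewrite !Z.add_opp_diag_r; change (tr 0 0) with gone; rewrite F1.
  rewrite (Hs (- k) (- l) (- i) (- j))%Z, (Hs (- k) (- l) k l)%Z, (Hs (- i) (- j) i j)%Z,
    (Hs (- (i + k)) (- (j + l)) (i + k) (j + l))%Z.
  lra. }
intros [[i j] []] [[k l] []];
  try (replace (i, j, true) with (gm gt (tr (- i) (- j))) by (unfold tr, gt; gsolve));
  try (replace (k, l, true) with (gm gt (tr (- k) (- l))) by (unfold tr, gt; gsolve));
  try change (i, j, false) with (tr i j); try change (k, l, false) with (tr k l);
  rewrite ?Ftt', ?Fntm, ?Ftn, ?F0; ring.
Qed.

(** Subtracting [rd1 h] changes the section so that it meets the normalisations of [rcocycle2_eq0];
    symmetry on translations survives because they commute. *)
Lemma rcocycle2_coboundary (F : Bas -> Bas -> R) : rcocycle2 F ->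
  F (tr 1 0) (tr 0 1) = F (tr 0 1) (tr 1 0) ->
  exists h, forall g k, F g k = rd1 h g k.
Proof.
intros HF H.
(* On reflections h solves 2 h(g) - h(1) = F g g with h(1) = [F gt gone]; on translations it solves
   h(g) - h(tg) + h(t) = [F gt g]. *)
set (hT := fun g => (F g g + F gt gone) / 2).
set (h := fun g : Bas => if snd g then hT g else F gt g + hT (gm gt g) - hT gt).
exists h.
assert (Hh1 : h gone = F gt gone).
{ unfold h; cbn [snd gone]; change (gm gt gone) with gt; ring. }
assert (E : forall g k, F g k - rd1 h g k = 0).
{ apply rcocycle2_eq0.
  - intros g k l; generalize (HF g k l) (rd1_cocycle h g k l); lra.
  - intros i j; unfold rd1.
    replace (gm (gm gt (tr i j)) (gm gt (tr i j))) with gone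
      by (unfold tr, gt, gone; gsolve).
    rewrite Hh1; unfold h; cbn [snd gm gt tr xorb]; unfold hT; field.
  - intros i j; unfold rd1, h; cbn [snd gm gt tr xorb]; ring.
  - intros i j k l; unfold rd1; rewrite (rcocycle2_sym F HF H), tr_comm; ring. }
intros g k; generalize (E g k); lra.
Qed.

(* Cup product of the two (sign-twisted) coordinate cocycles. *)
Definition area (g k : Bas) : R :=
  let '(a, _, e) := g in let '(_, d, _) := k in IZR (a * gsg e d).

Lemma area_cocycle : rcocycle2 area.
Proof.
intros g k l; gcases; cbn [gm area gsg xorb]; rewrite ?mult_IZR, ?plus_IZR, ?opp_IZR, ?plus_IZR, ?opp_IZR; ring.
Qed.

(** The obstruction in [rcocycle2_coboundary] is the antisymmetrised value at (U1, U2), which is 1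
    for [area]. *)
Lemma rcocycle2_class (F : Bas -> Bas -> R) : rcocycle2 F ->
  exists kappa h, forall g k, F g k - kappa * area g k = rd1 h g k.
Proof.
intros HF; exists (F (tr 1 0) (tr 0 1) - F (tr 0 1) (tr 1 0)).
set (kappa := (_ - _)%R).
apply (rcocycle2_coboundary (fun g k => F g k - kappa * area g k)).
- intros g k l; generalize (HF g k l) (f_equal (Rmult kappa) (area_cocycle g k l)); lra.
- cbn [area tr gsg]; unfold kappa; simpl (IZR _); ring.
Qed.

(** * The component at the identity and classes in degree two *)

Lemma act_gone (theta : R) (g : Bas) (phi : Dual) : act theta g phi gone = phi gone.
Proof.
unfold act.
replace (gconj g gone) with gone by (unfold gconj; gsolve).
replace (gex g gone) with 0%Z by (unfold gex; gsolve).
rewrite lam_0; ring.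
Qed.

Definition areaC (g k : Bas) : Dual := fun y =>
  if is_one y then (area g k, 0) else C0.

Lemma is_one_true (y : Bas) : is_one y = true -> y = gone.
Proof.
destruct y as [[i j] []]; cbn [is_one negb]; rewrite ?andb_false_r, ?andb_true_r; [discriminate|].
rewrite andb_true_iff, !Z.eqb_eq; now intros [-> ->].
Qed.

Lemma areaC_cocycle (theta : R) : cocycle2 theta areaC.
Proof.
intros g k l y; destruct (is_one y) eqn:E.
- apply is_one_true in E; subst y; unfold d2; rewrite act_gone; unfold areaC; simpl is_one; cbv iota.
  generalize (area_cocycle g k l); intros H.
  cbv [Csub Cadd Copp C0 fst snd]; f_equal; lra.
- unfold d2, act, areaC; rewrite is_one_conj, E; ring.
Qed.

(** At y = 1 the action is trivial, so a coboundary is symmetric on the commuting group elements U1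
    and U2, whereas [areaC] takes the values 1 and 0 there. *)
Lemma areaC_not_coboundary (theta : R) (c : C) (h : Bas -> Dual) :
  (forall g k y, Cmul c (areaC g k y) = d1 theta h g k y) -> c = C0.
Proof.
intros H.
assert (H1 := H (tr 1 0) (tr 0 1) gone); assert (H2 := H (tr 0 1) (tr 1 0) gone).
unfold d1 in H1, H2; rewrite !act_gone in H1, H2.
rewrite (tr_comm 0 1 1 0) in H2.
assert (E1 : areaC (tr 1 0) (tr 0 1) gone = C1) by reflexivity.
assert (E2 : areaC (tr 0 1) (tr 1 0) gone = C0) by reflexivity.
rewrite E1 in H1; rewrite E2 in H2.
transitivity (Csub (Cmul c C1) (Cmul c C0)); [ring|].
rewrite H1, H2; ring.
Qed.

Lemma cocycle2_class (theta : R) (F : Bas -> Bas -> Dual)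
  (Hirr : forall p q : Z, q <> 0%Z -> theta <> IZR p / IZR q) :
  cocycle2 theta F ->
  exists c h, forall g k y, Csub (F g k y) (Cmul c (areaC g k y)) = d1 theta h g k y.
Proof.
intros HF.
assert (HR : forall p : C -> R, (forall x y, p (Cadd x y) = p x + p y) ->
   (forall x, p (Copp x) = - p x) -> rcocycle2 (fun g k => p (F g k gone))).
{ intros p Hadd Hopp g k l; generalize (HF g k l gone); unfold d2; rewrite act_gone.
  intros H; apply (f_equal p) in H; unfold Csub in H.
  assert (Hp0 : p C0 = 0) by (generalize (Hadd C0 C0); replace (Cadd C0 C0) with C0 by ring; lra).
  rewrite !Hadd, !Hopp, Hp0 in H.
  lra. }
destruct (rcocycle2_class _ (HR (@fst R R) ltac:(reflexivity) ltac:(reflexivity))) as (c1 & h1 & H1).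
destruct (rcocycle2_class _ (HR (@snd R R) ltac:(reflexivity) ltac:(reflexivity))) as (c2 & h2 & H2).
(* The three homotopies are glued along the sets of reflections, of 1 and of nontrivial
   translations, each stable under conjugation. *)
exists (c1, c2), (fun (g y : Bas) => if snd y then tw2 F g y else
  if is_one y then (h1 g, h2 g) else ce2 theta F g y).
intros g k y; unfold d1.
destruct (snd y) eqn:Hy; [|destruct (is_one y) eqn:Hy1].
- rewrite <- (tw2_homotopy theta F g k y HF Hy).
  unfold d1, act; rewrite snd_conj, Hy; unfold areaC.
  destruct (is_one y) eqn:E; [apply is_one_true in E; subst y; discriminate | ring].
- apply is_one_true in Hy1; subst y.
  rewrite act_gone; cbv [areaC is_one gone Z.eqb andb negb snd].
  generalize (H1 g k) (H2 g k); unfold rd1; fold gone.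
  destruct (F g k gone) as [u v]; cbv [Csub Cadd Cmul Copp fst snd]; intros A1 A2.
  f_equal; lra.
- rewrite <- (ce2_homotopy theta F g k y Hirr HF Hy Hy1).
  unfold d1, act; rewrite snd_conj, is_one_conj, Hy, Hy1; unfold areaC; rewrite Hy1; ring.
Qed.

(** * Invariants and the Hochschild cohomology groups *)

(** This is the multiplicativity that makes [act] a group action. *)
Lemma gex_gm (g k z : Bas) : gex (gm g k) z = (gex g z + gex k (gconj g z))%Z.
Proof. unfold gex, gconj; gsolve. Qed.

Lemma gex_diag (y : Bas) : gex y y = 0%Z.
Proof. unfold gex; gsolve. Qed.

Definition parity (y : Bas) : Bas :=
  let '(i, j, e) := y in ((i mod 2)%Z, (j mod 2)%Z, e).

Lemma conj_half1 (y : Bas) : snd y = true -> gconj (half1 y) y = parity y.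
Proof.
destruct y as [[i j] e]; cbn [snd]; intros ->.
cbn [gconj gm gi gsg xorb half1 parity];
  repeat apply (f_equal2 pair); try reflexivity;
  Z.to_euclidean_division_equations; lia.
Qed.

Lemma half2_half1 (y : Bas) : snd y = true -> half2 y = gm (half1 y) (parity y).
Proof. destruct y as [[i j] e]; cbn [snd]; now intros ->. Qed.

Lemma parity_conj (g y : Bas) : snd y = true -> parity (gconj g y) = parity y.
Proof.
destruct y as [[i j] e]; cbn [snd]; intros ->.
destruct g as [[a b] []]; cbn [gconj gm gi gsg xorb parity];
  repeat apply (f_equal2 pair); try reflexivity;
  Z.to_euclidean_division_equations; lia.
Qed.

(** The two choices differ by the representative r = [parity y], which generates its own stabiliser
    and commutes with u_r without a scalar. Hence reflection classes carry invariant functionals. *)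
Lemma gex_half2 (y : Bas) : snd y = true -> gex (half2 y) y = gex (half1 y) y.
Proof.
intros Hy; rewrite half2_half1, gex_gm, conj_half1, gex_diag by assumption; ring.
Qed.

Lemma gex_half1_conj (g y : Bas) : snd y = true ->
  (gex g y + gex (half1 (gconj g y)) (gconj g y) = gex (half1 y) y)%Z.
Proof.
intros Hy; rewrite <- gex_gm.
destruct (conj_half g y Hy) as [[-> _] | [-> _]]; rewrite gmV;
  [reflexivity | now apply gex_half2].
Qed.

(* Conjugacy classes: 0 is that of 1, 1 to 4 are those of reflections, and 5
   lumps together the nontrivial translations. *)
Definition cls (y : Bas) : nat :=
  if snd y then
    match parity y with
    | (0%Z, 0%Z, _) => 1 | (_, 0%Z, _) => 2 | (0%Z, _, _) => 3 | _ => 4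
    end%nat
  else if is_one y then 0%nat else 5%nat.
Definition cls_rep (i : nat) : Bas :=
  match i with
  | 0 => gone | 1 => gt | 2 => (1, 0, true)%Z | 3 => (0, 1, true)%Z | _ => (1, 1, true)%Z
  end%nat.

Lemma cls_conj (g y : Bas) : cls (gconj g y) = cls y.
Proof.
unfold cls; rewrite snd_conj, is_one_conj.
destruct (snd y) eqn:Hy; [now rewrite parity_conj | reflexivity].
Qed.

Lemma conj_cls_rep (y : Bas) : (cls y < 5)%nat -> gconj (half1 y) y = cls_rep (cls y).
Proof.
unfold cls; destruct (snd y) eqn:Hy.
- intros _; rewrite conj_half1 by assumption.
  destruct y as [[i j] e]; cbn [snd] in Hy; subst e; cbn [parity].
  assert (Hi : (i mod 2 = 0 \/ i mod 2 = 1)%Z) by (Z.to_euclidean_division_equations; lia).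
  assert (Hj : (j mod 2 = 0 \/ j mod 2 = 1)%Z) by (Z.to_euclidean_division_equations; lia).
  destruct Hi as [-> | ->], Hj as [-> | ->]; reflexivity.
- destruct (is_one y) eqn:Hy1; [|lia]; intros _.
  apply is_one_true in Hy1; subst y; reflexivity.
Qed.

(** For i < 5, the invariant functional supported on class i with value 1 at [cls_rep i]. *)
Definition trace (theta : R) (i : nat) : Dual := fun y =>
  if Nat.eqb (cls y) i then lam_pow theta (gex (half1 y) y) else C0.

Lemma trace_invariant (theta : R) (i : nat) (g y : Bas) : (i < 5)%nat ->
  d0 theta (trace theta i) g y = C0.
Proof.
intros Hi; unfold d0, act, trace; rewrite cls_conj.
destruct (Nat.eqb_spec (cls y) i) as [E | _]; [|ring].
rewrite <- lam_add; unfold cls in E.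
destruct (snd y) eqn:Hy; [rewrite gex_half1_conj by assumption; ring|].
destruct (is_one y) eqn:Hy1; [|lia].
apply is_one_true in Hy1; subst y.
replace (gconj g gone) with gone by (unfold gconj; gsolve).
replace (gex g gone) with 0%Z by (unfold gex; gsolve).
rewrite Z.add_0_l; ring.
Qed.

Lemma invariant_on_class (theta : R) (phi : Dual) (y : Bas) :
  (forall g y, d0 theta phi g y = C0) -> (cls y < 5)%nat ->
  phi y = Cmul (phi (cls_rep (cls y))) (lam_pow theta (gex (half1 y) y)).
Proof.
intros H Hc; rewrite <- conj_cls_rep by assumption.
rewrite <- (Csub_eq0 _ _ (H (half1 y) y)) at 1; unfold act; ring.
Qed.

(** Invariance under n and n^-1 makes the nonzero scalar [cosgap] annihilate phi(y). *)
Lemma invariant_off_class (theta : R) (phi : Dual) (y : Bas)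
  (Hirr : forall p q : Z, q <> 0%Z -> theta <> IZR p / IZR q) :
  (forall g y, d0 theta phi g y = C0) -> ~ (cls y < 5)%nat -> phi y = C0.
Proof.
intros H Hc; unfold cls in Hc.
destruct (snd y) eqn:Hy.
{ destruct (parity y) as [[[] []] ?]; lia. }
destruct (is_one y) eqn:Hy1; [lia|].
rewrite <- (Cinv_real (cosgap theta y) C0 (phi y)).
- ring.
- now apply cosgap_neq0.
- rewrite <- act_mover, !(Csub_eq0 _ _ (H _ y)) by assumption; ring.
Qed.

Lemma lincomb_trace (theta : R) (k : nat) (c : nat -> C) (xs : list Bas) (y : Bas) :
  lincomb k c (fun i _ => trace theta i) xs y =
  if Nat.ltb (cls y) k then Cmul (c (cls y)) (lam_pow theta (gex (half1 y) y)) else C0.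
Proof.
induction k as [|k IH]; cbn [lincomb]; [reflexivity|].
rewrite IH; unfold trace.
destruct (Nat.ltb_spec (cls y) k), (Nat.ltb_spec (cls y) (S k)), (Nat.eqb_spec (cls y) k);
  try lia; subst; ring.
Qed.

Lemma cocycle0_d0 (theta : R) (f : Cochain) : cocycle theta 0 f ->
  forall g y, d0 theta (f nil) g y = C0.
Proof.
intros H g y.
apply (lam_cancel theta (gw g (gm (gi g) y))).
rewrite <- (gmV g y) at 2; rewrite <- hdiff0, H by reflexivity; ring.
Qed.

Lemma HH0 (theta : R) (Hirr : forall p q : Z, q <> 0%Z -> theta <> IZR p / IZR q) :
  HH_dim theta 0 5.
Proof.
exists (fun i _ => trace theta i); split; [|split].
- intros i Hi xs Hxs y; destruct xs as [|x [|]]; try discriminate.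
  rewrite hdiff0, trace_invariant by assumption; ring.
- intros f Hf; assert (H := cocycle0_d0 theta f Hf).
  exists (fun i => f nil (cls_rep i)); intros y; unfold csub; rewrite lincomb_trace.
  destruct (Nat.ltb_spec (cls y) 5) as [Hc | Hc].
  + rewrite <- (invariant_on_class theta _ y H Hc); ring.
  + rewrite (invariant_off_class theta (f nil) y Hirr H) by lia; ring.
- intros c Hc i Hi; assert (E := Hc (cls_rep i)); rewrite lincomb_trace in E.
  assert (Ei : cls (cls_rep i) = i /\ gex (half1 (cls_rep i)) (cls_rep i) = 0%Z).
  { do 5 (destruct i as [|i]; [split; reflexivity|]); lia. }
  destruct Ei as [E1 E2]; rewrite E1, E2, lam_0 in E.
  destruct (Nat.ltb_spec i 5); [|lia].
  rewrite <- E; ring.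
Qed.

(** * Degrees one and two *)

Lemma cocycle1_of_rep (theta : R) (f : Cochain) (D : Bas -> Dual) :
  rep1 theta f D -> cocycle theta 1 f -> cocycle1 theta D.
Proof.
intros HD Hf g k y.
set (z := gm (gi k) (gm (gi g) y)).
apply (lam_cancel theta (gw g (gm k z) + gw k z)).
replace y with (gm g (gm k z)) by (unfold z; now rewrite !gmV).
rewrite <- (hdiff1 theta f D), Hf by (assumption || reflexivity); ring.
Qed.

Lemma cocycle2_of_rep (theta : R) (f : Cochain) (F : Bas -> Bas -> Dual) :
  rep2 theta f F -> cocycle theta 2 f -> cocycle2 theta F.
Proof.
intros HF Hf g k l y.
set (z := gm (gi l) (gm (gi k) (gm (gi g) y))).
apply (lam_cancel theta (gw g (gm k (gm l z)) + gw k (gm l z) + gw l z)).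
replace y with (gm g (gm k (gm l z))) by (unfold z; now rewrite !gmV).
rewrite <- (hdiff2 theta f F), Hf by (assumption || reflexivity); ring.
Qed.

(* With trivial coefficients a 1-cocycle is a homomorphism to an additive group
   without 2-torsion; it kills the reflections, which generate. *)
Lemma cocycle1_gone (theta : R) (D : Bas -> Dual) (g : Bas) :
  cocycle1 theta D -> D g gone = C0.
Proof.
intros HD.
assert (H : forall g k, D (gm g k) gone = Cadd (D g gone) (D k gone)).
{ intros a b; rewrite <- (act_gone theta a (D b)), (cocycle1_eq theta D) by assumption; ring. }
assert (H2 : forall x, Cadd x x = C0 -> x = C0).
{ intros x Hx; rewrite <- (Chalf_double x).
  transitivity (Cmul Chalf (Cadd x x)); [ring | rewrite Hx; ring]. }
assert (H1 : D gone gone = C0).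
{ generalize (H gone gone); change (gm gone gone) with gone; intros E.
  transitivity (Csub (Cadd (D gone gone) (D gone gone)) (D gone gone)); [ring|].
  rewrite <- E; ring. }
assert (HR : forall i j, D (i, j, true) gone = C0).
{ intros i j; apply H2; rewrite <- H.
  replace (gm _ _) with gone by (unfold gone; gsolve); assumption. }
destruct g as [[i j] []]; [apply HR|].
replace (i, j, false) with (gm (i, j, true) gt) by (unfold gt; gsolve).
unfold gt; rewrite H, !HR; ring.
Qed.

Lemma cocycle1_coboundary (theta : R) (D : Bas -> Dual)
  (Hirr : forall p q : Z, q <> 0%Z -> theta <> IZR p / IZR q) :
  cocycle1 theta D -> exists m, forall g y, d0 theta m g y = D g y.
Proof.
intros HD.
(* At the identity [d0] of any functional is 0, in agreement with the vanishing of D there. *)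
exists (fun y : Bas => if snd y then tw1 D y else if is_one y then C0 else ce1 theta D y).
intros g y; unfold d0.
destruct (snd y) eqn:Hy; [|destruct (is_one y) eqn:Hy1].
- rewrite <- (tw1_homotopy theta D g y HD Hy).
  unfold d0, act; rewrite snd_conj, Hy; reflexivity.
- apply is_one_true in Hy1; subst y.
  rewrite act_gone, (cocycle1_gone theta) by assumption; cbn; ring.
- rewrite <- (ce1_homotopy theta D g y Hirr HD Hy Hy1).
  unfold d0, act; rewrite snd_conj, is_one_conj, Hy, Hy1; reflexivity.
Qed.

Lemma HH1 (theta : R) (Hirr : forall p q : Z, q <> 0%Z -> theta <> IZR p / IZR q) :
  HH_dim theta 1 0.
Proof.
exists (fun _ _ _ => C0); split; [|split]; try (intros; lia).
intros f Hf; exists (fun _ => C0).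
destruct (rep1_ex theta f) as [D HD].
destruct (cocycle1_coboundary theta D Hirr (cocycle1_of_rep theta f D HD Hf)) as [m Hm].
exists (fun _ => m); intros xs Hxs y; destruct xs as [|x [|]]; try discriminate.
rewrite hdiff0, Hm, <- HD; unfold csub; cbn [lincomb]; ring.
Qed.

(** The Hochschild cochain attached to [areaC] by [rep2]. *)
Definition area_cochain (theta : R) : Cochain := fun xs y =>
  match xs with
  | x :: x' :: _ =>
      Cmul (lam_pow theta (gw x (gm x' y) + gw x' y)) (areaC x x' (gm x (gm x' y)))
  | _ => C0
  end.

Lemma HH2 (theta : R) (Hirr : forall p q : Z, q <> 0%Z -> theta <> IZR p / IZR q) :
  HH_dim theta 2 1.
Proof.
exists (fun _ => area_cochain theta); split; [|split].
- intros _ _ xs Hxs y; destruct xs as [|x [|x' [|x'' [|]]]]; try discriminate.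
  rewrite (hdiff2 theta _ areaC), areaC_cocycle by easy; ring.
- intros f Hf; destruct (rep2_ex theta f) as [F HF].
  destruct (cocycle2_class theta F Hirr (cocycle2_of_rep theta f F HF Hf)) as (c & h & Hh).
  exists (fun _ => c).
  (* The Hochschild 1-cochain attached to h by [rep1]. *)
  exists (fun xs y => match xs with
    | x :: _ => Cmul (lam_pow theta (gw x y)) (h x (gm x y))
    | _ => C0
    end).
  intros xs Hxs y; destruct xs as [|x [|x' [|]]]; try discriminate.
  rewrite (hdiff1 theta _ h), <- Hh by easy.
  unfold csub; cbn [lincomb area_cochain]; rewrite HF; ring.
- intros c [g Hg] i Hi; replace i with 0%nat by lia.
  destruct (rep1_ex theta g) as [h Hh].
  apply (areaC_not_coboundary theta _ h); intros x x' y.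
  set (z := gm (gi x') (gm (gi x) y)).
  apply (lam_cancel theta (gw x (gm x' z) + gw x' z)).
  replace y with (gm x (gm x' z)) by (unfold z; now rewrite !gmV).
  rewrite <- (hdiff1 theta g h), <- Hg by (assumption || reflexivity).
  cbn [lincomb area_cochain]; unfold z; rewrite !gmV; ring.
Qed.

Theorem theorem1 (theta : R)
  (Hirr : forall p q : Z, q <> 0%Z -> theta <> IZR p / IZR q) :
  HH_dim theta 0 5 /\ HH_dim theta 1 0 /\ HH_dim theta 2 1.
Proof.
split; [|split]; [apply HH0 | apply HH1 | apply HH2]; assumption.
Qed.
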